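(* Let $p,q$ be positive integers and let $X_i$ ($i=1,\ldots,p$) and $Y_j$ ($j=1,\ldots,q$) be sets. Assume the following. (A1) There are normed spaces $(Z_i^X,\lVert\cdot\rVert_{Z_i^X})$, $(Z_j^Y,\lVert\cdot\rVert_{Z_j^Y})$ and injective maps $\iota_i^X:X_i\to Z_i^X$, $\iota_j^Y:Y_j\to Z_j^Y$. The sets $X_i$ and $Y_j$ are equipped with the induced metrics $d_i^X(x,x')=\lVert\iota_i^X(x)-\iota_i^X(x')\rVert_{Z_i^X}$ and $d_j^Y(y,y')=\lVert\iota_j^Y(y)-\iota_j^Y(y')\rVert_{Z_j^Y}$, and products of these sets with the corresponding max metrics. (A2) For all $n,m\in\mathbb N$ and all $i,j$ there are $a_{i,n},b_{j,m}\in\mathbb N$ and maps $$\Phi_{i,n}^X:X_i\to\mathbb R^{a_{i,n}},\quad \Psi_{i,n}^X:\mathbb R^{a_{i,n}}\to Z_i^X,\quad \Phi_{j,m}^Y:Y_j\to\mathbb R^{b_{j,m}},\quad \Psi_{j,m}^Y:\mathbb R^{b_{j,m}}\to Z_j^Y$$ such that $\Psi_{i,n}^X$ and $\Phi_{j,m}^Y$ are continuous, while $\Psi_{j,m}^Y$ is continuous at every point of $\Phi_{j,m}^Y(Y_j)$. Moreover, for all $i,j$ and every nonempty compact $C\subset X_i$ and $D\subset Y_j$, $$\lim_{n\to\infty}\sup_{x\in C}\lVert\Psi_{i,n}^X\circ\Phi_{i,n}^X(x)-\iota_i^X(x)\rVert_{Z_i^X}=0,\qquad \lim_{m\to\infty}\sup_{y\in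 D}\lVert\Psi_{j,m}^Y\circ\Phi_{j,m}^Y(y)-\iota_j^Y(y)\rVert_{Z_j^Y}=0.$$ Let $K_i\subset X_i$ be nonempty and compact, set $\boldsymbol K=\prod_{i=1}^pK_i$, and let $G=(G_1,\ldots,G_q):\boldsymbol K\to\prod_{j=1}^qY_j$ be continuous. Then for every $\varepsilon>0$ there exist $\boldsymbol n=(n_1,\ldots,n_p)\in\mathbb N^p$, $\boldsymbol m=(m_1,\ldots,m_q)\in\mathbb N^q$ and a continuous map $$F=(F^{(1)},\ldots,F^{(q)}):\prod_{i=1}^p\mathbb R^{a_{i,n_i}}\longrightarrow\prod_{j=1}^q\mathbb R^{b_{j,m_j}}$$ such that, writing $\boldsymbol x=(x_1,\ldots,x_p)$, $$\sup_{\boldsymbol x\in\boldsymbol K}\ \max_{1\le j\le q}\ \Bigl\lVert \Psi_{j,m_j}^Y\Bigl(F^{(j)}\bigl((\Phi_{i,n_i}^X(x_i))_{i=1}^p\bigr)\Bigr)-\iota_j^Y(G_j(\boldsymbol x))\Bigr\rVert_{Z_j^Y}<\varepsilon.$$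
   Context: Finite-dimensional spaces $\mathbb R^k$ carry their usual topology. Normed spaces are real and need not be complete. The encoders $\Phi_{i,n}^X$ on the input side are not assumed continuous. Compactness and continuity on $X_i$, $Y_j$ and their products refer to the induced metrics and max metrics described in (A1). *)

(* Defs.v *)
From HB Require Import structures.
From mathcomp Require Import all_boot all_order all_algebra.
From mathcomp Require Import all_classical all_reals all_analysis.

Set Implicit Arguments.
Unset Strict Implicit.
Unset Printing Implicit Defensive.

Import Order.TTheory GRing.Theory Num.Theory.
Import numFieldNormedType.Exports.

Local Open Scope classical_set_scope.
Local Open Scope ring_scope.

(* A copy of the bare type [X], carrying the metric pulled back along an
   injection into a normed space; injectivity is a parameter because it is what
   makes the pullback separated. *)
Definition induced_space (R : realType) (X : Type) (Z : normedModType R)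
  (iota : X -> Z) (_ : injective iota) : Type := X.

Section induced_metric.
Context (R : realType) (X : Type) (Z : normedModType R) (iota : X -> Z).
Context (iota_inj : injective iota).

HB.instance Definition _ := gen_eqMixin (induced_space iota_inj).
HB.instance Definition _ := gen_choiceMixin (induced_space iota_inj).

Definition induced_dist (x y : induced_space iota_inj) : R := `|iota x - iota y|.

Lemma induced_dist_refl x : induced_dist x x = 0.
Proof. by rewrite /induced_dist subrr normr0. Qed.

Lemma induced_dist_eq0 x y : induced_dist x y = 0 -> x = y.
Proof. by move=> /normr0_eq0 /subr0_eq /iota_inj. Qed.

Lemma induced_dist_sym x y : induced_dist x y = induced_dist y x.
Proof. exact: distrC. Qed.

Lemma induced_dist_triangle y x z :
  induced_dist x z <= induced_dist x y + induced_dist y z.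
Proof. exact: ler_distD. Qed.

HB.instance Definition _ := isMetric.Build R (induced_space iota_inj)
  induced_dist_refl induced_dist_eq0 induced_dist_sym induced_dist_triangle.

End induced_metric.

(* The dependent product of finitely many metric spaces, with the max metric
   (the pseudometric of the library's [prod_topology] is a different one). *)
Definition maxprod (R : realType) (p : nat) (T : 'I_p -> metricType R) : Type :=
  forall i, T i.

Definition box (R : realType) (p : nat) (T : 'I_p -> metricType R)
  (K : forall i, set (T i)) : set (maxprod T) := [set x | forall i, K i (x i)].

Section max_metric.
Context (R : realType) (p : nat) (T : 'I_p -> metricType R).

HB.instance Definition _ := gen_eqMixin (maxprod T).
HB.instance Definition _ := gen_choiceMixin (maxprod T).

Definition max_dist (x y : maxprod T) : R :=
  \big[Num.max/0]_(i < p) mdist (x i) (y i).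

Lemma max_dist_refl x : max_dist x x = 0.
Proof.
apply/eqP; rewrite eq_le bigmax_ge_id andbT.
by apply: bigmax_le => // i _; rewrite mdistxx.
Qed.

Lemma max_dist_eq0 x y : max_dist x y = 0 -> x = y.
Proof.
move=> xy0; apply: functional_extensionality_dep => i.
apply: mdist_positivity; apply/eqP; rewrite eq_le mdist_ge0 andbT -xy0.
exact: (le_bigmax _ (fun i => mdist (x i) (y i))).
Qed.

Lemma max_dist_sym x y : max_dist x y = max_dist y x.
Proof. by apply: eq_bigr => i _; rewrite metric_sym. Qed.

Lemma max_dist_triangle y x z : max_dist x z <= max_dist x y + max_dist y z.
Proof.
apply: bigmax_le => [|i _]; first by rewrite addr_ge0// bigmax_ge_id.
rewrite (le_trans (metric_triangle _ (y i) _))// lerD//.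
  exact: (le_bigmax _ (fun i => mdist (x i) (y i))).
exact: (le_bigmax _ (fun i => mdist (y i) (z i))).
Qed.

HB.instance Definition _ := isMetric.Build R (maxprod T)
  max_dist_refl max_dist_eq0 max_dist_sym max_dist_triangle.

End max_metric.

(* Main.v *)
Require Import Defs.
From mathcomp Require Import all_boot all_order all_algebra.
From mathcomp Require Import all_classical all_reals all_analysis.
From mathcomp Require Import lra.

(** The targets [G] can be replaced by their codes. On the compact image of
    [G_j] the decoder-encoder pair is uniformly close to the identity for a
    suitable index [m_j]; and since the decoder is continuous at each code
    [h_j x = PhiY_j (G_j x)] and these codes form a compact set, it is
    enough to come within a fixed [d_j] of [h_j x] ([compact_uniform_tube]).
    What remains is to approximate the continuous maps [h_j], defined on the
    compact box and valued in finite-dimensional spaces, by a continuous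
    function of the input codes.

    The input encoders may be discontinuous, so neither the set of codes nor
    the correspondence between codes and points has any topological
    regularity. But distances can be read off the codes continuously: the
    function [rho k u = max_i |iX_i k_i - PsiX_i u_i|] is continuous in the
    code [u], because the input decoders are, and at the code of [x] it is
    uniformly close to the distance from [k] to [x]. Take a fine finite net
    of the box and let [F_j] be the average of the values [h_j k] over the
    net, each weighted by a tent function of [rho k u]. At the code of [x]
    only net points close to [x] get a positive weight, so the average is
    close to [h_j x], and the nearest net point keeps the total weight away
    from zero; cutting the normalising factor off at that lower bound makes
    [F_j] continuous on the whole code space. This is [factor_through_code]. *)

Set Implicit Arguments.
Unset Strict Implicit.
Unset Printing Implicit Defensive.

Import Order.TTheory GRing.Theory Num.Theory.
Import numFieldNormedType.Exports.

Local Open Scope classical_set_scope.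
Local Open Scope ring_scope.

(** * Finite products of metric spaces *)

Lemma maxprod_proj_continuous (R : realType) (p : nat)
    (T : 'I_p -> metricType R) (i : 'I_p) :
  continuous (fun x : maxprod T => x i).
Proof.
move=> x A /nbhs_ballP[e /= e0 xeA]; apply/nbhs_ballP; exists e => //= y.
rewrite ballEmdist/= => xy; apply: xeA; rewrite ballEmdist/=.
exact: le_lt_trans (le_bigmax _ (fun i => mdist (x i) (y i)) i) xy.
Qed.

(** The index set is finite, so the identity from the product topology to the
    max metric is continuous and Tychonoff's theorem transfers. *)
Lemma box_compact (R : realType) (p : nat) (T : 'I_p -> metricType R)
    (K : forall i, set (T i)) :
  (forall i, compact (K i)) -> compact (box K).
Proof.
move=> /tychonoff cK.
pose f (x : prod_topology T) : maxprod T := x.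
have fc : continuous f.
  move=> x A /nbhs_ballP[e /= e0 xeA].
  have near_i i : \forall y \near x, mdist (x i) (y i) < e.
    have xe : nbhs (x i) (ball (x i) e) by exact: nbhsx_ballx.
    have := @proj_continuous _ T i x _ xe.
    by rewrite nbhs_simpl /proj ballEmdist.
  have := filter_forall (nbhs_filter x) near_i.
  apply: filterS => y xy; apply: xeA; rewrite ballEmdist/=.
  by apply: bigmax_lt.
have -> : box K = f @` [set x : prod_topology T | forall i, K i (x i)].
  by rewrite image_id.
apply: (@continuous_compact (prod_topology T)); last exact: cK.
exact: continuous_subspaceT.
Qed.

Lemma prod_topology_continuous (I : Type) (U : topologicalType)
    (T : I -> topologicalType) (f : U -> prod_topology T) :
  (forall i, continuous (fun u => f u i)) -> continuous f.
Proof.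
move=> fc u; apply/cvg_sup => i A [B [[C oC <-] fuC] CA].
by apply: filterS CA _; apply: fc; exact: open_nbhs_nbhs.
Qed.

(** * Uniformity on compact sets *)

(** The centres are required to lie in [K]: functions continuous within [K]
    are controlled only there. *)
Lemma compact_finite_net (R : realType) (T : pseudoMetricType R) (K : set T)
    (e : R) :
  compact K -> 0 < e ->
  exists s : seq T, (forall k, k \in s -> K k) /\
    forall x, K x -> exists2 k, k \in s & ball k e x.
Proof.
move=> cK e0.
(* Sequences of centres, directed by inclusion: eventually a sequence contains
   any given point. *)
pose S := filter_from setT (fun s : seq T => [set t : seq T | {subset s <= t}]).
have SF : Filter S.
  apply: filter_from_filter; first by exists [::].
  move=> s t _ _; exists (s ++ t) => // u su.
  by split=> k ks; apply: su; rewrite mem_cat ks ?orbT.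
have /compact_near_coveringP/near_covering_withinP cov := cK.
have [|s _ /(_ _ (fun k h => h)) sK] := cov _ S
    (fun t x => exists2 k, k \in [seq k <- t | `[< K k >]] & ball k e x) SF.
  move=> x Kx; exists (ball x e, [set t | x \in t]).
    split; first exact: nbhsx_ballx.
    by exists [:: x] => // t; apply; rewrite mem_head.
  move=> [y t] /= [xy xt] Ky; exists x => //.
  by rewrite mem_filter xt andbT; apply/asboolP.
exists [seq k <- s | `[< K k >]]; split=> [k|//].
by rewrite mem_filter => /andP[/asboolP].
Qed.

(** Statements that hold near every point of a compact set, for all small
    parameters, hold on the whole set for one common parameter: this is how
    both moduli below become uniform. *)
Lemma compact_common_radius (R : realType) (T : topologicalType) (K : set T)
    (P : R -> T -> Prop) :
  compact K ->
  (forall x, K x -> \forall x' \near x & r \near 0^'+, K x' -> P r x') ->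
  exists2 r : R, 0 < r & forall x, K x -> P r x.
Proof.
move=> /compact_near_coveringP/near_covering_withinP cK locP.
have unifP : \forall r \near 0^'+, K `<=` P r by exact: cK.
have [r [r0 Pr]] := filter_ex (filterI (nbhs_right_gt 0) unifP).
by exists r.
Qed.

Lemma compact_uniform_continuous (R : realType) (T : metricType R)
    (V : normedModType R) (K : set T) (g : T -> V) (d : R) :
  compact K -> {within K, continuous g} -> 0 < d ->
  exists2 r : R, 0 < r & forall x y, K x -> K y -> mdist x y < r ->
    `|g x - g y| < d.
Proof.
move=> cK /subspace_continuousP gc d0.
have [|r r0 rP] := @compact_common_radius R T K
  (fun r x => forall y, K y -> mdist x y < r -> `|g x - g y| < d) cK.
  move=> x Kx; have d20 : 0 < d / 2 by rewrite divr_gt0.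
  have /cvgrPdist_lt/(_ _ d20) := gc _ Kx.
  rewrite near_withinE => /nbhs_ballP[e /= e0 He].
  exists (ball x (e / 2), [set r | r < e / 2]) => /=.
    by split; [apply: nbhsx_ballx; rewrite divr_gt0|
      apply: nbhs_right_lt; rewrite divr_gt0].
  move=> [x' r] /= [xx' re] Kx' y Ky x'y.
  have gx' : `|g x - g x'| < d / 2.
    apply: He => //; apply: le_ball xx'.
    by rewrite ler_pdivrMr// ler_peMr ?ler1n// ltW.
  have gy : `|g x - g y| < d / 2.
    apply: He => //; rewrite (splitr e); apply: ball_triangle xx' _.
    by rewrite ballEmdist/=; exact: lt_trans re.
  rewrite -(subrKA (g x)) (le_lt_trans (ler_normD _ _))// (splitr d).
  by rewrite ltrD// distrC.
by exists r => // x y Kx; exact: rP.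
Qed.

(** Continuity of [f] is assumed at the points of [h @` K] only, but the bound
    reaches a whole neighbourhood of that set: the perturbed argument [v] need
    not be a value of [h]. *)
Lemma compact_uniform_tube (R : realType) (T : topologicalType)
    (V Z : normedModType R) (K : set T) (h : T -> V) (f : V -> Z) (e : R) :
  compact K -> {within K, continuous h} ->
  (forall x, K x -> {for h x, continuous f}) -> 0 < e ->
  exists2 d : R, 0 < d & forall x v, K x -> `|v - h x| <= d ->
    `|f v - f (h x)| < e.
Proof.
move=> cK /subspace_continuousP hc fc e0.
have [|r r0 rP] := @compact_common_radius R T K
  (fun d x => forall v, `|v - h x| <= d -> `|f v - f (h x)| < e) cK.
  move=> x Kx; have e20 : 0 < e / 2 by rewrite divr_gt0.
  have /cvgrPdist_lt/(_ _ e20)/nbhs_ballP[t /= t0 Ht] := fc _ Kx.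
  have t20 : 0 < t / 2 by rewrite divr_gt0.
  have /cvgrPdist_lt/(_ _ t20) := hc _ Kx.
  rewrite near_withinE => hx.
  exists ([set x' | K x' -> `|h x - h x'| < t / 2], [set d | d < t / 2]) => /=.
    by split => //; apply: nbhs_right_lt.
  move=> [x' d] /= [hx' dt] Kx' v vd; have {}hx' := hx' Kx'.
  have fx' : `|f (h x) - f (h x')| < e / 2.
    apply: Ht; rewrite -ball_normE/=; apply: (lt_trans hx').
    by rewrite ltr_pdivrMr// ltr_pMr// ltr1n.
  have fv : `|f (h x) - f v| < e / 2.
    apply: Ht; rewrite -ball_normE/= -(subrKA (h x')).
    rewrite (le_lt_trans (ler_normD _ _))// (splitr t) ltrD// distrC.
    exact: le_lt_trans dt.
  rewrite -(subrKA (f (h x))) (le_lt_trans (ler_normD _ _))// (splitr e).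
  by rewrite ltrD// distrC.
by exists r => // x v Kx; exact: rP.
Qed.

(** * Continuous functions of approximate codes *)

Lemma weighted_average_close (R : realType) (V : normedModType R) (I : eqType)
    (s : seq I) (w : I -> R) (g : I -> V) (y : V) (d : R) :
  (forall k, k \in s -> 0 <= w k) ->
  (forall k, k \in s -> 0 < w k -> `|g k - y| <= d) ->
  0 < \sum_(k <- s) w k ->
  `|(\sum_(k <- s) w k)^-1 *: (\sum_(k <- s) w k *: g k) - y| <= d.
Proof.
move=> w0 wg W0; set W := \sum_(k <- s) w k.
have -> : W^-1 *: (\sum_(k <- s) w k *: g k) - y =
    W^-1 *: \sum_(k <- s) w k *: (g k - y).
  under [in RHS]eq_bigr do rewrite scalerBr.
  by rewrite sumrB -scaler_suml scalerBr scalerA mulVf ?scale1r// gt_eqF.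
rewrite normrZ gtr0_norm ?invr_gt0// mulrC ler_pdivrMr//.
apply: (le_trans (ler_norm_sum _ _ _)); rewrite mulr_sumr.
rewrite big_seq [leRHS]big_seq; apply: ler_sum => k ks.
rewrite normrZ ger0_norm ?w0// mulrC.
have := w0 k ks; rewrite le_eqVlt => /predU1P[<-|wk]; first by rewrite !mulr0.
by rewrite ler_pM2r// wg.
Qed.

Lemma bigmax_continuous (R : realType) (U : topologicalType) (I : Type)
    (s : seq I) (f : I -> U -> R) :
  (forall i, continuous (f i)) ->
  continuous (fun u => \big[Num.max/0]_(i <- s) f i u).
Proof.
move=> fc; apply: continuous_big => // x.
by apply: (@continuous_max R _ fst snd); [exact: cvg_fst|exact: cvg_snd].
Qed.

Lemma bigmax_dist_lt (R : realType) (I : Type) (s : seq I) (f g : I -> R)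
    (e : R) :
  0 < e -> (forall i, `|f i - g i| < e) ->
  `|\big[Num.max/0]_(i <- s) f i - \big[Num.max/0]_(i <- s) g i| < e.
Proof.
move=> e0 fg; elim/big_ind2 : _ => [|x1 x2 y1 y2|i _]; rewrite ?subrr ?normr0//.
rewrite !ltr_distl => /andP[? ?] /andP[? ?].
by rewrite maxEle [Num.max x2 y2]maxEle; case: ifP; case: ifP; lra.
Qed.

(** The map [E] stands for an encoder, about which nothing is assumed except
    that its codes determine distances to within [eta] through the continuous
    functions [rho k]. The threshold [eta] comes before the code space [U],
    because the encoders are selected only once the required accuracy is
    known. *)
Lemma factor_through_code (R : realType) (T : metricType R)
    (V : normedModType R) (K : set T) (g : T -> V) (d : R) :
  compact K -> {within K, continuous g} -> 0 < d ->
  exists2 eta : R, 0 < eta &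
    forall (U : topologicalType) (E : T -> U) (rho : T -> U -> R),
      (forall k, continuous (rho k)) ->
      (forall k x, K k -> K x -> `|rho k (E x) - mdist k x| < eta) ->
      exists2 F : U -> V, continuous F &
        forall x, K x -> `|F (E x) - g x| <= d.
Proof.
move=> cK gc d0; have [r r0 gr] := compact_uniform_continuous cK gc d0.
(* The error budget for a net of mesh [eta]: the net point near [x] has
   [rho < 2 * eta], hence weight above [eta], while a positive weight means
   [rho < 3 * eta], hence true distance below [4 * eta = r]. *)
pose eta := r / 4; have eta0 : 0 < eta by rewrite divr_gt0.
exists eta => // U E rho rhoc rhoE.
have [s [sK net]] := compact_finite_net cK eta0.
pose w k u := Num.max 0 (3 * eta - rho k u).
have wc k : continuous (w k).
  move=> u; apply: (@continuous_max R _ (cst 0) (fun u => 3 * eta - rho k u)).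
    exact: cvg_cst.
  by apply: cvgB; [exact: cvg_cst|exact: rhoc].
pose W u := \sum_(k <- s) w k u.
have Wc : continuous W.
  by apply: continuous_big => // x; exact: add_continuous.
(* The cut-off at [eta] keeps the quotient continuous at the points of [U]
   where [W] vanishes; it is inactive at codes of points of [K]. *)
exists (fun u => (Num.max eta (W u))^-1 *: \sum_(k <- s) w k u *: g k).
  move=> u; apply: cvgZ.
    apply: cvgV; first by rewrite gt_eqF// lt_max eta0.
    apply: (@continuous_max R _ (cst eta) W); first exact: cvg_cst.
    exact: Wc.
  apply: (@continuous_big _ _ _ _ xpredT) => // [x|k _ v].
    exact: add_continuous.
  by apply: cvgZr_tmp; exact: wc.
move=> x Kx.
have [k ks kx] := net x Kx.
have Wx : eta < W (E x).
  have wk : eta < w k (E x).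
    rewrite /w lt_max; apply/orP; right.
    move: kx; rewrite ballEmdist/=; have := rhoE k x (sK _ ks) Kx.
    by rewrite ltr_distl => /andP[_]; lra.
  rewrite (lt_le_trans wk)// /W (big_rem k ks)/= lerDl.
  by apply: sumr_ge0 => j _; rewrite le_max lexx.
rewrite max_r ?(ltW Wx)//; apply: weighted_average_close.
- by move=> j _; rewrite le_max lexx.
- move=> j js; rewrite lt_max ltxx/= => jx.
  apply/ltW/gr => //; first exact: sK.
  have := rhoE j x (sK _ js) Kx; rewrite ltr_distl => /andP[+ _].
  by move: jx; rewrite /eta; lra.
- exact: lt_trans Wx.
Qed.

(** * Approximation of the map on the box *)

Theorem theorem3p1 (R : realType) (p q : nat) (p_gt0 : (0 < p)%N) (q_gt0 : (0 < q)%N)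
    (X : 'I_p -> Type) (Y : 'I_q -> Type)
    (ZX : 'I_p -> normedModType R) (ZY : 'I_q -> normedModType R)
    (iX : forall i, X i -> ZX i) (iY : forall j, Y j -> ZY j)
    (iX_inj : forall i, injective (iX i)) (iY_inj : forall j, injective (iY j))
    (a : 'I_p -> nat -> nat) (b : 'I_q -> nat -> nat)
    (PhiX : forall i n, induced_space (iX_inj i) -> 'rV[R]_(a i n))
    (PsiX : forall i n, 'rV[R]_(a i n) -> ZX i)
    (PhiY : forall j m, induced_space (iY_inj j) -> 'rV[R]_(b j m))
    (PsiY : forall j m, 'rV[R]_(b j m) -> ZY j)
    (PsiX_cont : forall i n, continuous (PsiX i n))
    (PhiY_cont : forall j m, continuous (PhiY j m))
    (PsiY_cont : forall j m y, {for PhiY j m y, continuous (PsiY j m)})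
    (X_approx : forall i (C : set (induced_space (iX_inj i))), C !=set0 -> compact C ->
      ereal_sup [set (`|PsiX i n (PhiX i n x) - iX i x|)%:E | x in C]
        @[n --> \oo] --> 0%E)
    (Y_approx : forall j (D : set (induced_space (iY_inj j))), D !=set0 -> compact D ->
      ereal_sup [set (`|PsiY j m (PhiY j m y) - iY j y|)%:E | y in D]
        @[m --> \oo] --> 0%E)
    (K : forall i, set (induced_space (iX_inj i)))
    (K_neq0 : forall i, K i !=set0) (K_compact : forall i, compact (K i))
    (G : maxprod (fun i => induced_space (iX_inj i)) -> maxprod (fun j => induced_space (iY_inj j)))
    (G_cont : {within box K, continuous G})
    (eps : R) (eps_gt0 : 0 < eps) :
  exists (n : 'I_p -> nat) (m : 'I_q -> nat)
    (F : prod_topology (fun i => 'rV[R]_(a i (n i))) ->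
         prod_topology (fun j => 'rV[R]_(b j (m j)))),
    continuous F /\
    (ereal_sup
      [set (\big[Num.max/0]_(j < q)
             `|PsiY j (m j) (F (fun i => PhiX i (n i) (x i)) j) - iY j (G x j)|)%:E
        | x in box K] < eps%:E)%E.
Proof.
have cB := box_compact K_compact.
pose Gj j x := G x j.
have Gjc j : {within box K, continuous (Gj j)}.
  move=> x; apply: (@continuous_comp (subspace (box K))
    (maxprod (fun j => induced_space (iY_inj j))) (induced_space (iY_inj j))
    G (fun y => y j)); first exact: G_cont.
  exact: maxprod_proj_continuous.
have [x0 Kx0] := all_sig (fun i => cid (K_neq0 i)).
have sup_lt (I : Type) (A : set I) (f : I -> R) (e : R) :
    (ereal_sup [set (f x)%:E | x in A] < e%:E)%E -> forall x, A x -> f x < e.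
  move=> supe x Ax; rewrite -lte_fin; apply: le_lt_trans supe.
  by apply: ereal_sup_ubound; exists x.
have nbhs_lt (e : R) : 0 < e -> nbhs 0%E [set z : \bar R | (z < e%:E)%E].
  move=> e0; apply: (@open_nbhs_nbhs _ (0%E : \bar R)).
  by split; [exact: open_ereal_lt_ereal|rewrite /= lte_fin].
have eps4 : 0 < eps / 4 by rewrite divr_gt0.
have /choice[m mP] (j : 'I_q) : exists m, forall x, box K x ->
    `|PsiY j m (PhiY j m (G x j)) - iY j (G x j)| < eps / 4.
  have cD := continuous_compact (Gjc j) cB.
  have [||m _ Hm] := Y_approx j _ _ cD [set z | (z < (eps / 4)%:E)%E].
  - by exists (Gj j x0), x0.
  - exact: nbhs_lt.
  exists m => x Kx.
  have := sup_lt _ _ (fun y => `|PsiY j m (PhiY j m y) - iY j y|) _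
    (Hm m (leqnn m)) (Gj j x).
  by apply; exists x.
pose h j x := PhiY j (m j) (G x j).
have hc j : {within box K, continuous (h j)}.
  move=> x; apply: (@continuous_comp (subspace (box K))
    (induced_space (iY_inj j)) _ (Gj j) (PhiY j (m j))); first exact: Gjc.
  exact: PhiY_cont.
have /all_sig2[d d0 dP] (j : 'I_q) := cid2 (compact_uniform_tube cB (hc j)
  (fun x _ => @PsiY_cont j (m j) (G x j)) eps4).
have /all_sig2[eta eta0 etaP] (j : 'I_q) :=
  cid2 (factor_through_code cB (hc j) (d0 j)).
(* A single index [n i] has to serve all [q] output components at once. *)
have /choice[n nP] (i : 'I_p) : exists n, forall j x, K i x ->
    `|PsiX i n (PhiX i n x) - iX i x| < eta j.
  have : \forall n \near \oo, forall j, (ereal_sup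
      [set (`|PsiX i n (PhiX i n x) - iX i x|)%:E | x in K i] < (eta j)%:E)%E.
    apply: filter_forall => j.
    apply: (X_approx i _ (K_neq0 i) (K_compact i) [set z | (z < (eta j)%:E)%E]).
    exact: nbhs_lt.
  by case=> n _ /(_ n (leqnn n)) Hn; exists n => j; exact: sup_lt.
pose U := prod_topology (fun i => 'rV[R]_(a i (n i))).
pose E (x : maxprod (fun i => induced_space (iX_inj i))) : U :=
  fun i => PhiX i (n i) (x i).
pose rho (k : maxprod (fun i => induced_space (iX_inj i))) (u : U) : R :=
  \big[Num.max/0]_(i < p) `|iX i (k i) - PsiX i (n i) (u i)|.
have rhoc k : continuous (rho k).
  have Psic i : continuous (fun u : U => PsiX i (n i) (u i)).
    move=> u; apply: (@continuous_comp U _ _ (proj i) (PsiX i (n i))).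
      exact: proj_continuous.
    exact: PsiX_cont.
  apply: bigmax_continuous => i u; apply: (@cvg_norm _ _ _ (nbhs (u : U))).
  by apply: (@cvgB _ _ _ (nbhs (u : U))); [exact: cvg_cst|exact: Psic].
have rhoE j k x : box K k -> box K x -> `|rho k (E x) - mdist k x| < eta j.
  move=> _ Kx; apply: bigmax_dist_lt => // i.
  apply: le_lt_trans (nP i j (x i) (Kx i)).
  rewrite (le_trans (ler_dist_dist _ _))// opprB addrC addrA subrK.
  by rewrite distrC.
have /all_sig2[F Fc FP] (j : 'I_q) :=
  cid2 (etaP j U E rho rhoc (rhoE j)).
exists n, m, (fun u j => F j u); split; first exact: prod_topology_continuous.
apply: (@le_lt_trans _ _ (eps / 2)%:E); last first.
  by rewrite lte_fin ltr_pdivrMr// ltr_pMr// ltr1n.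
apply: ge_ereal_sup => _ [x Kx <-]; rewrite lee_fin.
apply: bigmax_le => [|j _]; first by rewrite divr_ge0// ltW.
rewrite -(subrKA (PsiY j (m j) (h j x))) (le_trans (ler_normD _ _))//.
have := dP j x _ Kx (FP j x Kx); have := mP j x Kx; rewrite /E/h; lra.
Qed.
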